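(* Let $g$ be any Markov transition kernel on $\mathcal{X}$ with unique stationary measure $\pi$ and (finite) mixing time $t_m$. Then $$t_H\left(\tfrac13\right)\le 12\,t_m .$$
   Context: $\mathcal{X}$ is a topological space with Borel $\sigma$-field $\mathcal{B}[\mathcal{X}]$; $g(x,t,\cdot)$ denotes the $t$-step kernel; $\mathbb{N}=\{0,1,2,\dots\}$; $\|\mu-\nu\|_{\mathrm{TV}}=\sup_A|\mu(A)-\nu(A)|$. The mixing time is $t_m=\min\{t\ge0:\sup_{x\in\mathcal{X}}\|g(x,t,\cdot)-\pi(\cdot)\|_{\mathrm{TV}}\le\frac14\}$. For the chain $\{X_t\}_{t\in\mathbb{N}}$ with kernel $g$, $\tau(A)=\min\{t\in\mathbb{N}:X_t\in A\}$, and the maximum hitting time is $t_H(\alpha)=\sup\{\mathbb{E}_x[\tau(A)]:x\in\mathcal{X},\ A\in\mathcal{B}[\mathcal{X}],\ \pi(A)\ge\alpha\}$, where $x$ is the starting point. *)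

(* Defs.v *)
From HB Require Import structures.
From mathcomp Require Import all_boot all_order all_algebra.
From mathcomp Require Import all_classical all_reals all_analysis.

Set Implicit Arguments.
Unset Strict Implicit.
Unset Printing Implicit Defensive.

Import Order.TTheory GRing.Theory Num.Theory.
Import numFieldNormedType.Exports.

Local Open Scope classical_set_scope.
Local Open Scope ring_scope.
Local Open Scope ereal_scope.

(* T equipped with its Borel sigma-algebra. Measurable types are pointed in
   the library; a space carrying a probability measure is nonempty anyway. *)
Notation borelType T := (g_sigma_algebraType (@open T)).

Section total_variation_distance.
Context d (T : measurableType d) (R : realType).

Definition tv_dist (mu nu : {measure set T -> \bar R}) : \bar R :=
  ereal_sup [set `|mu A - nu A| | A in measurable].

End total_variation_distance.

Section markov_kernel.
Context d (T : measurableType d) (R : realType).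
Variable g : R.-pker T ~> T.

(* The library states closure under composition for subprobability kernels
   only; every [kstep t] nevertheless has total mass 1. *)
Fixpoint kstep (t : nat) : R.-spker T ~> T :=
  if t is t'.+1 then mkcomp_noparam g (kstep t')
  else kdirac (@measurable_id _ T setT).

Definition stationary (pi : probability T R) : Prop :=
  forall A, measurable A -> \int[pi]_x g x A = pi A.

Definition unique_stationary (pi : probability T R) : Prop :=
  stationary pi /\
  forall nu : probability T R, stationary nu ->
    forall A, measurable A -> nu A = pi A.

Definition mixed_at (pi : probability T R) (t : nat) : Prop :=
  ereal_sup [set tv_dist (kstep t x) pi | x in [set: T]] <= (4^-1)%R%:E.

(* In particular the mixing time is finite. *)
Definition is_mixing_time (pi : probability T R) (tm : nat) : Prop :=
  mixed_at pi tm /\ forall t, mixed_at pi t -> (tm <= t)%N.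

Section chain.
Context dO (Omega : measurableType dO).
Variable X : nat -> {mfun Omega >-> T}.

Definition history (t : nat) : set (set Omega) :=
  <<s \bigcup_(s in [set s | (s <= t)%N])
        preimage_set_system setT (X s) measurable >>.

(* Under P, the process X starts at x and satisfies
   P (X (t + 1) \in B | X 0, ..., X t) = g (X t) B  almost surely. The second
   clause is the defining property of this conditional probability. The
   initial law is given as a Dirac mass since {x} need not be measurable. *)
Definition markov_chain (P : probability Omega R) (x : T) : Prop :=
  (forall B, measurable B -> P (X 0%N @^-1` B) = \d_x B) /\
  (forall t E B, history t E -> measurable B ->
    P (E `&` X t.+1 @^-1` B) = \int[P]_(w in E) g (X t w) B).

(* +oo when A is never hit *)
Definition hitting_time (A : set T) (w : Omega) : \bar R :=
  ereal_inf [set t%:R%:E | t in [set t : nat | A (X t w)]].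

(* P x is the law of the chain started at x. *)
Definition max_hitting_time (P : T -> probability Omega R)
    (pi : probability T R) (alpha : R) : \bar R :=
  ereal_sup [set e | exists x : T, exists A : set T,
    [/\ measurable A, alpha%:E <= pi A &
        e = \int[P x]_w hitting_time A w]].

End chain.
End markov_kernel.

(* Main.v *)
Require Import Defs.
From HB Require Import structures.
From mathcomp Require Import all_boot all_order all_algebra.
From mathcomp Require Import all_classical all_reals all_analysis.
From mathcomp Require Import measurable_realfun lra.

(** By the mixing bound, from every state the chain is in [A] after [tm] steps
    with probability at least [1/3 - 1/4 = 1/12]. Hence the probability that
    [A] is missed at all of the times [tm, 2 tm, ..., k tm] is at most
    [(11/12) ^ k], and summing the geometric series gives
    [E (tau A) <= tm / (1 - 11/12) = 12 tm]. *)

Set Implicit Arguments.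
Unset Strict Implicit.
Unset Printing Implicit Defensive.

Import Order.TTheory GRing.Theory Num.Theory.
Import numFieldNormedType.Exports.

Local Open Scope classical_set_scope.
Local Open Scope ring_scope.
Local Open Scope ereal_scope.

(** The integral of a nonnegative function is a supremum over the simple functions below it, and
    these index sets are nested. This allows [hitting_time] to be compared with a series under the
    integral without a proof that it is measurable. *)
Lemma ge0_le_integral_unmeasurable d (T : measurableType d) (R : realType)
    (mu : {measure set T -> \bar R}) (f1 f2 : T -> \bar R) :
  (forall x, 0 <= f1 x) -> (forall x, f1 x <= f2 x) ->
  \int[mu]_x f1 x <= \int[mu]_x f2 x.
Proof.
move=> f10 f12; rewrite !ge0_integralTE//; last first.
  by move=> x; exact: le_trans (f12 x).
apply: le_ereal_sup => _ [h hf <-]; exists h => // x.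
exact: le_trans (f12 x).
Qed.

Section constant_kernel.
Context d d' (X : measurableType d) (Y : measurableType d') (R : realType).
Variable mu : {measure set Y -> \bar R}.
Hypothesis mufin : mu setT \is a fin_num.

(* The finiteness proof is only carried along for instance resolution. *)
Definition kconst of mu setT \is a fin_num := fun _ : X => mu.

Let measurable_kconst U : measurable U ->
  measurable_fun [set: X] (kconst mufin ^~ U).
Proof. by move=> _; exact: measurable_cst. Qed.

HB.instance Definition _ :=
  isKernel.Build _ _ _ _ _ (kconst mufin) measurable_kconst.

Let kconst_uub : measure_fam_uub (kconst mufin).
Proof.
exists (fine (mu setT) + 1)%R => x.
by rewrite /kconst EFinD fineK// lteDl// lte_fin.
Qed.

HB.instance Definition _ :=
  Kernel_isFinite.Build _ _ _ _ _ (kconst mufin) kconst_uub.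

End constant_kernel.

Section markov_property.
Context d (T : measurableType d) (R : realType) (g : R.-pker T ~> T).
Context dO (Omega : measurableType dO) (X : nat -> {mfun Omega >-> T}).
Variables (P : probability Omega R) (x : T).
Hypothesis chainX : markov_chain g X P x.

Lemma history_measurable t E : history X t E -> measurable E.
Proof.
move=> hE; have : (@measurable _ Omega) E; last by [].
apply: hE; split; first exact: sigma_algebra_measurable.
by move=> _ [s _ [B mB <-]]; rewrite setTI; exact: measurable_funPTI.
Qed.

Lemma sub_history s t : (s <= t)%N -> history X s `<=` history X t.
Proof.
move=> st; apply: sub_sigma_algebra2 => E [i /= si XE]; exists i => //=.
exact: leq_trans st.
Qed.

Lemma history_setI t E F : history X t E -> history X t F ->
  history X t (E `&` F).
Proof.
by move=> hE hF; apply: (@measurableI _ (g_sigma_algebraType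
  (\bigcup_(s in [set s | (s <= t)%N])
        preimage_set_system setT (X s) measurable))).
Qed.

Lemma history_preimage t B : measurable B -> history X t (X t @^-1` B).
Proof.
move=> mB; apply: sub_sigma_algebra; exists t => //=.
by exists B => //; rewrite setTI.
Qed.

(** The second clause of [markov_chain] is the case where [f] is an indicator. It says that two
    measures on [T] agree, hence so do their integrals of [f]. *)
Lemma markov_integral t E (f : T -> \bar R) : history X t E ->
  measurable_fun setT f -> (forall y, 0 <= f y) ->
  \int[P]_(w in E) f (X t.+1 w) = \int[P]_(w in E) \int[g (X t w)]_y f y.
Proof.
move=> hE mf f0; have mE := history_measurable hE.
have PE (h : Omega -> \bar R) :
    measurable_fun setT h -> (forall w, 0 <= h w) ->
    \int[mrestr P mE]_w h w = \int[P]_(w in E) h w.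
  (* [mrestr P mE] gives no mass to the complement of [E] and agrees with [P] on the measurable
     subsets of [E]. *)
  move=> mh h0; rewrite (@ge0_negligible_integral _ _ _ _ _ (~` E))//.
  - rewrite setTD setCK; apply: eq_measure_integral => B mB BE.
    by rewrite /= /mrestr setIidl.
  - exact: measurableC.
  - by rewrite /= /mrestr setICl measure0.
have PXE s (h : T -> \bar R) : measurable_fun setT h -> (forall y, 0 <= h y) ->
    \int[pushforward (mrestr P mE) (X s)]_y h y =
    \int[P]_(w in E) h (X s w).
  move=> mh h0; rewrite ge0_integral_pushforward// preimage_setT PE//=.
  exact: measurableT_comp.
(* Both sides integrate [f] against the composition of [g] with the law of
   [X t] on [E]; that law is made a kernel, constant in its argument, so as to
   use [integral_kcomp]. *)
pose push := [the measure _ _ of pushforward (mrestr P mE) (X t)].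
pose nu := push (measurable_funPT (X t)).
have nufin : nu setT \is a fin_num.
  by apply: fin_num_measure; exact: measurable_funPTI.
pose l : R.-sfker T ~> T := @kconst _ _ T _ _ _ nufin.
rewrite -PXE// (eq_measure_integral (kcomp l (kernel.kernel_snd g) x)).
  rewrite integral_kcomp// -(PXE t (fun y => \int[g y]_z f z))//.
  - by apply: measurable_fun_integral_kernel => // U; exact: measurable_kernel.
  - by move=> y; exact: integral_ge0.
move=> B mB _.
transitivity (\int[pushforward (mrestr P mE) (X t)]_y g y B); last by [].
rewrite PXE//; last exact: measurable_kernel.
by rewrite -(chainX.2 _ _ _ hE mB) /pushforward /mrestr setIC.
Qed.

(** Induction on [n] for all [t]: [kstep] unfolds at its first step, so the induction hypothesis is
    applied from time [t.+1], and [markov_integral] leads back from [t.+1] to [t]. *)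
Lemma markov_kstep n t E B : history X t E -> measurable B ->
  P (E `&` X (t + n)%N @^-1` B) = \int[P]_(w in E) kstep g n (X t w) B.
Proof.
elim: n t E => [|n IHn] t E hE mB.
  rewrite addn0 setIC -integral_indic//.
  - exact: history_measurable hE.
  - exact: measurable_funPTI.
rewrite addnS -addSn IHn//; last exact: (sub_history (leqnSn t)).
apply: (markov_integral hE) => //.
exact: measurable_kernel.
Qed.

End markov_property.

Section missed.
Context d (T : measurableType d) (R : realType).
Context dO (Omega : measurableType dO) (X : nat -> {mfun Omega >-> T}).
Variables (A : set T) (n : nat).

Fixpoint missed k : set Omega :=
  if k is k'.+1 then missed k' `&` X (k * n)%N @^-1` (~` A) else setT.

Lemma missed_history k : measurable A -> history X (k * n) (missed k).
Proof.
move=> mA; elim: k => [|k IHk].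
  exact: (@history_preimage _ _ _ _ X (0 * n) setT measurableT).
apply: history_setI.
  by apply: sub_history IHk; rewrite leq_mul2r leqnSn orbT.
by apply: history_preimage; exact: measurableC.
Qed.

(** The events [missed i] decrease in [i], so all the indicators equal 1 at [w]. *)
Lemma missed_sum k w : missed k w ->
  (\sum_(0 <= i < k.+1) \1_(missed i) w = k.+1%:R :> R)%R.
Proof.
elim: k => [|k IHk] Mw; rewrite big_nat_recr//= indicE mem_set//.
  by rewrite big_geq// add0r.
by rewrite IHk ?natr1//; case: Mw.
Qed.

(** Let [j.+1] be the first index at which [missed] fails at [w]. Then [A] is hit at time
    [j.+1 * n], and the indicators of [missed 0], ..., [missed j] already contribute [j.+1] to the
    sum. *)
Lemma hitting_time_le_sum k w : ~ missed k w ->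
  hitting_time R X A w <= (n%:R * \sum_(0 <= i < k) \1_(missed i) w)%:E.
Proof.
elim: k => [|k IHk] nMw; first by case: nMw.
have [Mkw|/IHk/le_trans] := pselect (missed k w); last first.
  apply; rewrite lee_fin ler_wpM2l// big_nat_recr//= lerDl.
  by rewrite indicE.
rewrite missed_sum// -natrM mulnC; apply: ereal_inf_lbound => /=.
by exists (k.+1 * n)%N => //=; apply: contrapT => nA; apply: nMw.
Qed.

Lemma hitting_time_le_series w : (0 < n)%N ->
  hitting_time R X A w <= \sum_(i <oo) (n%:R * \1_(missed i) w)%:E.
Proof.
move=> n0.
have ge0 i : 0 <= (n%:R * \1_(missed i) w)%:E :> \bar R.
  by rewrite lee_fin mulr_ge0.
have lower k : (n%:R * \sum_(0 <= i < k) \1_(missed i) w)%:E <=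
    \sum_(i <oo) (n%:R * \1_(missed i) w)%:E :> \bar R.
  apply: le_trans (nneseries_lim_ge k _); last by move=> i _ _.
  by rewrite mulr_sumr sumEFin.
have [[k nMw]|/forallNP Mw] := pselect (exists k, ~ missed k w).
  exact: le_trans (hitting_time_le_sum nMw) _.
(* Every [missed k] now holds at [w], so each term is [n], which is at least 1, and the partial sums
   pass any real [r]. *)
suff -> : \sum_(i <oo) (n%:R * \1_(missed i) w)%:E = +oo :> \bar R.
  by rewrite leey.
apply/eqyP => r r0.
apply: le_trans (lower (Num.truncn r).+1).
rewrite missed_sum; last exact: contrapT.
rewrite lee_fin (le_trans (ltW (truncnS_gt r)))//.
by rewrite ler_peMl// ler1n.
Qed.

Lemma expected_hitting_time_le (g : R.-pker T ~> T) (P : probability Omega R)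
    (x : T) (c : R) : (0 < n)%N -> (0 < c < 1)%R -> markov_chain g X P x ->
  measurable A -> (forall y, kstep g n y (~` A) <= c%:E) ->
  \int[P]_w hitting_time R X A w <= (n%:R / (1 - c))%:E.
Proof.
move=> n0 /andP[c0 c1] chainX mA missA.
have mM k : measurable (missed k).
  exact: history_measurable (missed_history mA).
have PM k : P (missed k) <= (c ^+ k)%:E.
  elim: k => [|k IHk]; first by rewrite /= probability_setT.
  (* Time [k.+1 * n] is reached from [k * n] in [n] steps, and [missed k] belongs to the history up
     to [k * n]; missing [A] once more therefore costs a factor [c]. *)
  rewrite [missed _]/= mulSn addnC.
  rewrite (markov_kstep chainX n (missed_history mA) (measurableC mA)).
  apply: (@le_trans _ _ (\int[P]_(w in missed k) c%:E)).
    apply: ge0_le_integral => //.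
    exact/measurable_funTS/(measurableT_comp
      (measurable_kernel (kstep g n) _ (measurableC mA))).
  by rewrite integral_cst// exprS EFinM lee_pmul2l// lte_fin.
apply: (@le_trans _ _ (\int[P]_w \sum_(i <oo) (n%:R * \1_(missed i) w)%:E)).
  apply: ge0_le_integral_unmeasurable => w; last exact: hitting_time_le_series.
  by apply: le_ereal_inf_tmp => _ [t _ <-]; rewrite lee_fin.
(* Sum and integral are exchanged by nonnegativity; it then suffices to bound each partial sum by
   the full geometric series. *)
rewrite integral_nneseries//; last first.
  by move=> i; apply/measurable_EFinP; exact: measurable_funM.
apply: lime_le => //.
  apply: is_cvg_nneseries => i _ _; apply: integral_ge0 => w _.
  by rewrite lee_fin mulr_ge0.
apply: nearW => k.
apply: (@le_trans _ _ (\sum_(0 <= i < k) (n%:R * c ^+ i)%:E)).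
  apply: lee_sum => i _; under eq_integral do rewrite EFinM.
  rewrite ge0_integralZl//; last exact/measurable_EFinP.
  by rewrite integral_indic// setIT EFinM lee_wpmul2l// PM.
rewrite sumEFin lee_fin.
have := @geometric_le_lim _ k n%:R c.
rewrite /series /=; apply => //.
by rewrite gtr0_norm.
Qed.

End missed.

(** The complement of [A] has [pi]-mass at most [1 - a], and mixing adds at most [1/4]. *)
Lemma mixed_at_miss d (T : measurableType d) (R : realType)
    (g : R.-pker T ~> T) (pi : probability T R) t (A : set T) (a : R) x :
  mixed_at g pi t -> measurable A -> a%:E <= pi A ->
  kstep g t x (~` A) <= (5 / 4 - a)%:E.
Proof.
move=> mixt mA piA.
have mAC := measurableC mA.
have : `|kstep g t x (~` A) - pi (~` A)| <= (4^-1)%:E.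
  apply: le_trans mixt; apply: le_trans (ereal_sup_ubound _); last first.
    by exists x.
  by apply: ereal_sup_ubound; exists (~` A).
have kfin : kstep g t x (~` A) \is a fin_num.
  rewrite ge0_fin_numE//; apply: (@le_lt_trans _ _ 1); last exact: ltry.
  apply: le_trans (sprob_kernel_le1 (kstep g t) x).
  by apply: le_measure => //; rewrite inE.
rewrite probability_setC//.
have pfin : pi A \is a fin_num by exact: fin_num_measure.
move: piA; rewrite -(fineK kfin) -(fineK pfin).
rewrite !lee_fin => piA /ler_normlP[_].
by lra.
Qed.

Theorem mainTheorem5 (R : realType) (S : ptopologicalType)
    (g : R.-pker (borelType S) ~> (borelType S))
    (pi : probability (borelType S) R) (tm : nat)
    (dO : measure_display) (Omega : measurableType dO)
    (P : borelType S -> probability Omega R)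
    (X : nat -> {mfun Omega >-> borelType S}) :
  unique_stationary g pi ->
  is_mixing_time g pi tm ->
  (forall x, markov_chain g X (P x) x) ->
  max_hitting_time X P pi (3^-1)%R <= 12%:E * tm%:R%:E.
Proof.
move=> _ [mixtm _] chainX; apply: ge_ereal_sup => _ [x [A [mA piA ->]]].
have miss y := mixed_at_miss y mixtm mA piA.
case: tm => [|m] in mixtm miss *.
  (* A mixing time of 0 forces [A] to be the whole space. *)
  rewrite mule0 integral0_eq// => w _.
  apply/eqP; rewrite eq_le; apply/andP; split; last first.
    by apply: le_ereal_inf_tmp => _ [t _ <-]; rewrite lee_fin.
  apply: ereal_inf_lbound; exists 0%N => //=; apply: contrapT => nA.
  (* [kstep g 0] is a Dirac mass, so a state outside [A] would give [1 <= 11/12]. *)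
  have := miss (X 0%N w).
  rewrite /= /kdirac /= diracE mem_set//= lee_fin.
  by lra.
apply: le_trans (expected_hitting_time_le _ _ (chainX x) mA miss) _ => //.
  by apply/andP; split; lra.
rewrite -EFinM lee_fin.
have -> : (1 - (5 / 4 - 3^-1) = 12^-1 :> R)%R by lra.
by rewrite invrK mulrC.
Qed.
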